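(* Let $(\gamma,\nu):I\to\mathbb{R}^2\times S^1$ be a Legendre curve with curvature $(\ell,\beta)$ and $\beta=\alpha\ell$, where $\alpha:I\to\mathbb{R}$ is the unique smooth function with this property (so the evolute of $\gamma$ exists). Let $n,k\in\mathbb{N}$ be positive integers and $m=n+k$. (1) Case $n=k$: if $\gamma$ has four points of type $(n,m)=(n,2n)$ with $\dot f(0)=0$ (where $f$ is the function germ in the normal form at each such point), then $\gamma$ has at least four vertices. (2) Case $n=k+1$: if $\gamma$ has four points of type $(n,m)=(n,2n-1)$, then $\gamma$ has at least four vertices. (3) Case $n\ge k+2$: if $\gamma$ has two points of type $(n,m)$, then $\gamma$ has at least four vertices.
   Context: All maps are $C^\infty$; $I$ is a closed interval. $\mathbb{R}^2$ has the standard inner product, $S^1\subset\mathbb{R}^2$ is the unit circle, and $J(x,y)=(-y,x)$. A smooth map $(\gamma,\nu):I\to\mathbb{R}^2\times S^1$ is a Legendre curve if $\dot\gamma(t)\cdot\nu(t)=0$ for all $t\in I$; then $\gamma$ is called a frontal. Put $\mu=J(\nu)$. The curvature $(\ell,\beta)$ is $\ell=\dot\nu\cdot\mu$, $\beta=\dot\gamma\cdot\mu$, so that $\dot\nu=\ell\mu$, $\dot\mu=-\ell\nu$, $\dot\gamma=\beta\mu$. The evolute of the frontal exists if there is a unique smooth $\alpha:I\to\mathbb{R}$ with $\beta=\alpha\ell$; it is then $\mathcal{E}v(\gamma)=\gamma-\alpha\nu$. A point $t_0\in I$ is a vertex of $\gamma$ if the evolute exists and $\frac{d}{dt}\mathcal{E}v(\gamma)(t_0)=0$,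 equivalently $\dot\alpha(t_0)=0$. Type $(n,m)$: with $n,k$ positive integers and $m=n+k$, $\gamma$ has a point $t_0$ of type $(n,m)$ if, after translating $\gamma(t_0)$ to the origin, the germ of $(\gamma,\nu)$ at $t_0$ is $\mathcal{R}$-equivalent to (i.e. equal, after composition with a diffeomorphism germ of the source taking $t_0$ to $0$, to) a germ $(\widetilde\gamma,\widetilde\nu):(\mathbb{R},0)\to\mathbb{R}^2\times S^1$ of the form $$\widetilde\gamma(t)=(\pm t^n,t^mf(t)),\qquad \widetilde\nu(t)=\frac{(-mt^kf(t)-t^{k+1}\dot f(t),\,\pm n)}{\sqrt{(mt^kf(t)+t^{k+1}\dot f(t))^2+n^2}},$$ with the same sign in both places, where $f:(\mathbb{R},0)\to\mathbb{R}$ is a smooth function germ with $f(0)\ne0$.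
   Formalization: Parts (2) and (3) are false on a general interval I=[a,b] (only three vertices may occur); there the formal theorem assumes that all derivatives of α agree at a and b, and counts points of type (n,m) and vertices in [a,b), with a and b identified. *)

(* Defs.v *)
From Stdlib Require Import Reals List.
From Coquelicot Require Import Coquelicot.
Open Scope R_scope.

(* A smooth map on the closed interval [a, b] is represented by a smooth map
   defined on all of R, of which only the values on [a, b] matter (every map
   smooth on [a, b] has such an extension). By smoothness its derivatives at
   points of [a, b], endpoints included, are determined by those values. *)
Definition smooth (f : R -> R) : Prop :=
  forall (j : nat) (t : R), ex_derive_n f j t.

Definition smooth_near (t0 : R) (f : R -> R) : Prop :=
  locally t0 (fun t => forall j : nat, ex_derive_n f j t).

Definition in_interval (a b t : R) : Prop := a <= t <= b.

Definition plane : Type := (R * R)%type.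

Definition dot (u v : plane) : R := fst u * fst v + snd u * snd v.
Definition J (u : plane) : plane := (- snd u, fst u).
Definition psub (u v : plane) : plane := (fst u - fst v, snd u - snd v).
Definition pscal (c : R) (u : plane) : plane := (c * fst u, c * snd u).

Definition smooth_curve (g : R -> plane) : Prop :=
  smooth (fun t => fst (g t)) /\ smooth (fun t => snd (g t)).

Definition velocity (g : R -> plane) (t : R) : plane :=
  (Derive (fun s => fst (g s)) t, Derive (fun s => snd (g s)) t).

Definition legendre_curve (a b : R) (gamma nu : R -> plane) : Prop :=
  smooth_curve gamma /\ smooth_curve nu /\
  forall t, in_interval a b t ->
    dot (nu t) (nu t) = 1 /\ dot (velocity gamma t) (nu t) = 0.

Definition mu (nu : R -> plane) (t : R) : plane := J (nu t).

Definition ell (nu : R -> plane) (t : R) : R :=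
  dot (velocity nu t) (mu nu t).

Definition beta (gamma nu : R -> plane) (t : R) : R :=
  dot (velocity gamma t) (mu nu t).

(* alpha is the unique smooth function on [a, b] with beta = alpha ell, i.e.
   the evolute exists and alpha is the function defining it. Uniqueness is
   equality on [a, b], alpha being represented by an extension to R. *)
Definition evolute_function (a b : R) (gamma nu : R -> plane)
    (alpha : R -> R) : Prop :=
  smooth alpha /\
  (forall t, in_interval a b t -> beta gamma nu t = alpha t * ell nu t) /\
  (forall alpha' : R -> R, smooth alpha' ->
    (forall t, in_interval a b t -> beta gamma nu t = alpha' t * ell nu t) ->
    forall t, in_interval a b t -> alpha' t = alpha t).

Definition evolute (gamma nu : R -> plane) (alpha : R -> R) (t : R) : plane :=
  psub (gamma t) (pscal (alpha t) (nu t)).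

Definition vertex (a b : R) (gamma nu : R -> plane) (t0 : R) : Prop :=
  in_interval a b t0 /\
  exists alpha : R -> R,
    evolute_function a b gamma nu alpha /\
    velocity (evolute gamma nu alpha) t0 = (0, 0).

(* Normal form of type (n, n + k); eps = 1 or -1 is the sign. *)
Definition gamma_nf (n k : nat) (eps : R) (f : R -> R) (t : R) : plane :=
  (eps * t ^ n, t ^ (n + k) * f t).

Definition slope_nf (n k : nat) (f : R -> R) (t : R) : R :=
  INR (n + k) * t ^ k * f t + t ^ (k + 1) * Derive f t.

Definition nu_nf (n k : nat) (eps : R) (f : R -> R) (t : R) : plane :=
  pscal (/ sqrt (slope_nf n k f t ^ 2 + INR n ^ 2))
        (- slope_nf n k f t, eps * INR n).

(* phi represents a diffeomorphism germ (R, t0) -> (R, 0). *)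
Definition diffeo_germ (t0 : R) (phi : R -> R) : Prop :=
  smooth_near t0 phi /\ phi t0 = 0 /\
  exists psi : R -> R,
    smooth_near 0 psi /\ psi 0 = t0 /\
    locally t0 (fun t => psi (phi t) = t) /\
    locally 0 (fun s => phi (psi s) = s).

(* At an endpoint of [a, b] the germ of the curve is one-sided, so the
   identity is required only at the parameters lying in [a, b]. *)
Definition of_type_with (a b : R) (gamma nu : R -> plane) (n k : nat)
    (f : R -> R) (t0 : R) : Prop :=
  in_interval a b t0 /\
  smooth_near 0 f /\ f 0 <> 0 /\
  exists (eps : R) (phi : R -> R),
    (eps = 1 \/ eps = -1) /\
    diffeo_germ t0 phi /\
    locally t0 (fun t => in_interval a b t ->
      psub (gamma t) (gamma t0) = gamma_nf n k eps f (phi t) /\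
      nu t = nu_nf n k eps f (phi t)).

(* t0 is a point of type (n, n + k). *)
Definition of_type (a b : R) (gamma nu : R -> plane) (n k : nat)
    (t0 : R) : Prop :=
  exists f : R -> R, of_type_with a b gamma nu n k f t0.

(* alpha is a smooth function on the circle obtained from [a, b] by
   identifying a and b. When the Legendre curve is closed (all derivatives of
   gamma and nu agree at a and b) this is automatic unless ell vanishes to
   infinite order at the endpoints. *)
Definition closes_up (a b : R) (alpha : R -> R) : Prop :=
  forall j : nat, Derive_n alpha j a = Derive_n alpha j b.

Definition at_least (N : nat) (P : R -> Prop) : Prop :=
  exists l : list R, NoDup l /\ length l = N /\ forall t, In t l -> P t.

(* Main.v *)
Require Import Defs.
From Stdlib Require Import Reals List Lra Lia Sorting.Sorted.
From Coquelicot Require Import Coquelicot.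
Open Scope R_scope.

(* Near a point of type (n, n + k), in the parameter s of the normal form and
   with sigma(s) = s^k (m f + s f') = slope_nf, one computes (up to a common
   factor phi') beta = - s^(n-1) sqrt (sigma^2 + n^2) and
   ell = eps n sigma' / (sigma^2 + n^2) with sigma' = s^(k-1) K(s), K(0) <> 0.
   Hence alpha = - eps s^(n-k) (sigma^2 + n^2)^(3/2) / (n K(s)). This gives
   alpha' = 0 when n = k and f'(0) = 0, alpha = 0 when n = k + 1, and
   alpha = alpha' = 0 when n >= k + 2. Vertices are the zeros of alpha', and the
   missing ones come from Rolle's theorem between consecutive zeros of alpha on
   the circle. *)

(** * One-sided germs at points of a closed interval *)

Lemma exists_punctured_near (a b t0 r : R) :
  a < b -> in_interval a b t0 -> 0 < r ->
  exists t, a < t < b /\ t <> t0 /\ Rabs (t - t0) < r.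
Proof.
intros hab [h1 h2] hr.
destruct (Rlt_dec t0 b) as [h | h].
- assert (hm : 0 < Rmin (b - t0) r) by (apply Rmin_glb_lt; lra).
  pose proof (Rmin_l (b - t0) r). pose proof (Rmin_r (b - t0) r).
  exists (t0 + Rmin (b - t0) r / 2).
  repeat split; try lra. rewrite Rabs_pos_eq; lra.
- assert (hm : 0 < Rmin (t0 - a) r) by (apply Rmin_glb_lt; lra).
  pose proof (Rmin_l (t0 - a) r). pose proof (Rmin_r (t0 - a) r).
  exists (t0 - Rmin (t0 - a) r / 2).
  repeat split; try lra. rewrite Rabs_left; lra.
Qed.

(** Continuity and the difference quotient at [t0] are tested on a single nearby point of the open
    interval, so endpoints are covered too. It extends identities known only inside the interval and
    off [t0] to [t0] itself, to first order. *)
Lemma vanishing_germ_on_interval (a b : R) (d : R -> R) (t0 : R) :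
  a < b -> in_interval a b t0 -> ex_derive d t0 ->
  locally t0 (fun t => a < t < b -> t <> t0 -> d t = 0) ->
  d t0 = 0 /\ Derive d t0 = 0.
Proof.
intros hab ht0 hd [r0 hr0].
assert (hv : d t0 = 0).
{ destruct (Req_dec (d t0) 0) as [|hne]; [assumption | exfalso].
  pose proof (ex_derive_continuous d t0 hd) as hc.
  apply continuity_pt_filterlim in hc.
  destruct (hc (Rabs (d t0)) (Rabs_pos_lt _ hne)) as [r [hr hc']].
  destruct (exists_punctured_near a b t0 (Rmin r r0)) as [t [ht [htne htr]]];
    [easy | easy | apply Rmin_glb_lt; [lra | apply cond_pos] |].
  pose proof (Rmin_l r r0). pose proof (Rmin_r r r0).
  assert (hb : ball t0 r0 t) by (change (Rabs (t - t0) < r0); lra).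
  specialize (hc' t). simpl in hc'. unfold R_dist in hc'.
  rewrite (hr0 t hb ht htne) in hc'.
  replace (0 - d t0) with (- d t0) in hc' by ring. rewrite Rabs_Ropp in hc'.
  assert (Rabs (d t0) < Rabs (d t0)); [apply hc' | lra].
  split; [split; [exact I | congruence] | lra]. }
split; [assumption |].
destruct (Req_dec (Derive d t0) 0) as [|hne]; [assumption | exfalso].
pose proof (Derive_correct d t0 hd) as hD. apply is_derive_Reals in hD.
destruct (hD (Rabs (Derive d t0)) (Rabs_pos_lt _ hne)) as [r hr].
destruct (exists_punctured_near a b t0 (Rmin r r0)) as [t [ht [htne htr]]];
  [easy | easy | apply Rmin_glb_lt; apply cond_pos |].
pose proof (Rmin_l r r0). pose proof (Rmin_r r r0).
assert (hb : ball t0 r0 t) by (change (Rabs (t - t0) < r0); lra).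
specialize (hr (t - t0) ltac:(lra) ltac:(lra)).
replace (t0 + (t - t0)) with t in hr by ring.
rewrite (hr0 t hb ht htne), hv in hr.
replace ((0 - 0) / (t - t0) - Derive d t0) with (- Derive d t0) in hr
  by (field; lra).
rewrite Rabs_Ropp in hr. lra.
Qed.

(** * Legendre curves and vertices as critical points of [alpha] *)

Lemma smooth_ex_derive (f : R -> R) (t : R) : smooth f -> ex_derive f t.
Proof. intros h. exact (h 1%nat t). Qed.

Lemma smooth_ex_derive2 (f : R -> R) (t : R) :
  smooth f -> ex_derive (Derive f) t.
Proof. intros h. exact (h 2%nat t). Qed.

(** Differentiate [dot nu nu = 1]. This identity is given only on the interval, so at an endpoint
    the vanishing derivative comes from the one-sided germ argument. *)
Lemma legendre_velocity_nu (a b : R) (gamma nu : R -> plane) (t : R) :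
  a < b -> legendre_curve a b gamma nu -> in_interval a b t ->
  dot (velocity nu t) (nu t) = 0.
Proof.
intros hab [_ [[h1 h2] hL]] ht.
pose proof (smooth_ex_derive _ t h1) as e1.
pose proof (smooth_ex_derive _ t h2) as e2.
set (x := fun s => fst (nu s)) in *. set (y := fun s => snd (nu s)) in *.
assert (hd : is_derive (fun s => x s * x s + y s * y s - 1) t
               (2 * (Derive x t * x t + Derive y t * y t))).
{ auto_derive; [easy |].
  change (Derive (fun s => x s) t) with (Derive x t).
  change (Derive (fun s => y s) t) with (Derive y t). ring. }
destruct (vanishing_germ_on_interval a b
            (fun s => x s * x s + y s * y s - 1) t) as [_ h0]; try easy.
- now exists (2 * (Derive x t * x t + Derive y t * y t)).
- exists (mkposreal 1 Rlt_0_1). intros s _ hs _.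
  destruct (hL s) as [hs1 _]; [split; lra |].
  unfold dot in hs1. unfold x, y. lra.
- pose proof (eq_trans (eq_sym (is_derive_unique _ _ _ hd)) h0) as h3.
  change (Derive x t * x t + Derive y t * y t = 0). lra.
Qed.

(** When [alpha] is critical, the velocity of the evolute is [gamma' - alpha nu']. It is orthogonal
    to [nu] by the Legendre conditions ([E1]) and to [mu] by [beta = alpha ell] ([E2]), and these
    two vectors form an orthonormal basis. *)
Lemma vertex_of_critical (a b : R) (gamma nu : R -> plane) (alpha : R -> R)
    (t : R) :
  a < b -> legendre_curve a b gamma nu ->
  evolute_function a b gamma nu alpha -> in_interval a b t ->
  Derive alpha t = 0 -> vertex a b gamma nu t.
Proof.
intros hab hL hev ht hd.
split; [assumption |]. exists alpha. split; [assumption |].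
pose proof (legendre_velocity_nu a b gamma nu t hab hL ht) as h3.
destruct hL as [[g1 g2] [[n1 n2] hL]].
destruct (hL t ht) as [h1 h2].
destruct hev as [ha [hb _]]. specialize (hb t ht).
pose proof (smooth_ex_derive _ t g1) as eg1.
pose proof (smooth_ex_derive _ t g2) as eg2.
pose proof (smooth_ex_derive _ t n1) as en1.
pose proof (smooth_ex_derive _ t n2) as en2.
pose proof (smooth_ex_derive _ t ha) as ea.
unfold velocity, evolute, psub, pscal; simpl.
unfold beta, ell, mu, J, dot, velocity in hb, h1, h2, h3; simpl in *.
set (X1 := fun s => fst (gamma s)) in *. set (X2 := fun s => snd (gamma s)) in *.
set (N1 := fun s => fst (nu s)) in *. set (N2 := fun s => snd (nu s)) in *.
change (fst (nu t)) with (N1 t) in *. change (snd (nu t)) with (N2 t) in *.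
assert (D1 : Derive (fun s => X1 s - alpha s * N1 s) t
             = Derive X1 t - alpha t * Derive N1 t).
{ apply is_derive_unique. auto_derive; [easy |].
  change (Derive (fun s => X1 s) t) with (Derive X1 t).
  change (Derive (fun s => N1 s) t) with (Derive N1 t).
  change (Derive (fun s => alpha s) t) with (Derive alpha t).
  rewrite hd. ring. }
assert (D2 : Derive (fun s => X2 s - alpha s * N2 s) t
             = Derive X2 t - alpha t * Derive N2 t).
{ apply is_derive_unique. auto_derive; [easy |].
  change (Derive (fun s => X2 s) t) with (Derive X2 t).
  change (Derive (fun s => N2 s) t) with (Derive N2 t).
  change (Derive (fun s => alpha s) t) with (Derive alpha t).
  rewrite hd. ring. }
change ((Derive (fun s => X1 s - alpha s * N1 s) t,
         Derive (fun s => X2 s - alpha s * N2 s) t) = (0, 0)).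
rewrite D1, D2.
set (u1 := Derive X1 t) in *. set (u2 := Derive X2 t) in *.
set (v1 := Derive N1 t) in *. set (v2 := Derive N2 t) in *.
set (p := N1 t) in *. set (q := N2 t) in *. set (al := alpha t) in *.
assert (E1 : (u1 - al * v1) * p + (u2 - al * v2) * q = 0).
{ replace ((u1 - al * v1) * p + (u2 - al * v2) * q)
    with ((u1 * p + u2 * q) - al * (v1 * p + v2 * q)) by ring.
  rewrite h2, h3. ring. }
assert (E2 : (u1 - al * v1) * - q + (u2 - al * v2) * p = 0) by lra.
f_equal.
- replace (u1 - al * v1) with ((u1 - al * v1) * (p * p + q * q))
    by (rewrite h1; ring).
  replace ((u1 - al * v1) * (p * p + q * q)) with
    (((u1 - al * v1) * p + (u2 - al * v2) * q) * p
     - ((u1 - al * v1) * - q + (u2 - al * v2) * p) * q) by ring.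
  rewrite E1, E2. ring.
- replace (u2 - al * v2) with ((u2 - al * v2) * (p * p + q * q))
    by (rewrite h1; ring).
  replace ((u2 - al * v2) * (p * p + q * q)) with
    (((u1 - al * v1) * p + (u2 - al * v2) * q) * q
     + ((u1 - al * v1) * - q + (u2 - al * v2) * p) * p) by ring.
  rewrite E1, E2. ring.
Qed.

(** * The function [alpha] in the normal form *)

(* The derivative of [slope_nf n k f] is [t ^ (k - 1) * slope_factor n k f t]. *)
Definition slope_factor (n k : nat) (f : R -> R) (t : R) : R :=
  INR k * INR (n + k) * f t + INR (n + 2 * k + 1) * t * Derive f t
  + t ^ 2 * Derive (Derive f) t.

Lemma is_derive_slope_nf (n k : nat) (f : R -> R) (t : R) :
  (1 <= k)%nat -> ex_derive f t -> ex_derive (Derive f) t ->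
  is_derive (slope_nf n k f) t (t ^ (k - 1) * slope_factor n k f t).
Proof.
intros hk h1 h2. destruct k as [|k]; [lia |].
unfold slope_nf, slope_factor.
replace (n + 2 * S k + 1)%nat with ((n + S k) + S (S k))%nat by lia.
replace (S k + 1)%nat with (S (S k)) by lia.
replace (S k - 1)%nat with k by lia.
rewrite (plus_INR (n + S k)).
set (m := INR (n + S k)).
apply is_derive_ext with
  (fun s => m * (s * s ^ k) * f s + s * (s * s ^ k) * Derive f s).
{ intros s. simpl. ring. }
auto_derive; [easy |].
change (Derive (fun x => f x) t) with (Derive f t).
change (Derive (fun x => Derive (fun x0 => f x0) x) t)
  with (Derive (Derive f) t).
change (Derive (fun x => Derive f x) t) with (Derive (Derive f) t).
rewrite !S_INR.
(* Differentiating [s ^ k] produces the exponent [Nat.pred k], so the exponent 0 is treated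
   apart. *)
destruct k as [|k]; [simpl; ring |].
replace (Nat.pred (S k)) with k by lia. rewrite !S_INR. simpl pow. ring.
Qed.

Definition speed_nf (n k : nat) (f : R -> R) (t : R) : R :=
  sqrt (slope_nf n k f t ^ 2 + INR n ^ 2).

(** The truncated subtraction [n - k] is the true one when [k <= n], which is assumed wherever this
    formula is compared with [alpha]. Since [eps] is a sign, it stands in the numerator in place of
    its inverse. *)
Definition alpha_nf (n k : nat) (eps : R) (f : R -> R) (t : R) : R :=
  - eps * t ^ (n - k) * speed_nf n k f t ^ 3
  / (INR n * slope_factor n k f t).

(** Away from the zero of [phi] the curvature component [ell] is nonzero, so [beta = alpha ell] can
    be solved for [alpha]. Reparametrization multiplies both [beta] and [ell] by [phi'], which
    cancels. *)
Lemma evolute_function_nf (a b : R) (gamma nu : R -> plane) (alpha : R -> R)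
    (n k : nat) (eps : R) (f phi : R -> R) (v : plane) (t : R) :
  (1 <= k)%nat -> (k <= n)%nat -> eps = 1 \/ eps = -1 ->
  ex_derive phi t -> Derive phi t <> 0 -> phi t <> 0 ->
  ex_derive f (phi t) -> ex_derive (Derive f) (phi t) ->
  slope_factor n k f (phi t) <> 0 ->
  locally t (fun s => psub (gamma s) v = gamma_nf n k eps f (phi s) /\
                      nu s = nu_nf n k eps f (phi s)) ->
  beta gamma nu t = alpha t * ell nu t ->
  alpha t = alpha_nf n k eps f (phi t).
Proof.
intros hk hkn heps ephi hq hp ef1 ef2 hK hloc hb.
assert (hn0 : 0 < INR n) by (apply lt_0_INR; lia).
assert (heps2 : eps * eps = 1) by (destruct heps; subst; ring).
pose proof (is_derive_slope_nf n k f (phi t) hk ef1 ef2) as hs.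
pose proof (Derive_correct phi t ephi) as hphi.
set (p := phi t) in *. set (q := Derive phi t) in *.
assert (hS : is_derive (fun s => slope_nf n k f (phi s)) t
               (q * (p ^ (k - 1) * slope_factor n k f p)))
  by exact (is_derive_comp (slope_nf n k f) phi t _ _ hs hphi).
set (S := fun s => slope_nf n k f (phi s)) in hS.
assert (eS : ex_derive S t) by (eexists; exact hS).
apply is_derive_unique in hS.
change (Derive S t = q * (p ^ (k - 1) * slope_factor n k f p)) in hS.
set (K := slope_factor n k f p) in *.
assert (hr : 0 < S t ^ 2 + INR n ^ 2) by nra.
assert (hsq : 0 < sqrt (S t ^ 2 + INR n ^ 2)) by now apply sqrt_lt_R0.
assert (G1 : Derive (fun s => fst (gamma s)) t = eps * INR n * p ^ (n - 1) * q).
{ rewrite (Derive_ext_loc _ (fun s => fst v + eps * phi s ^ n)).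
  - apply is_derive_unique. auto_derive; [easy |].
    change (Derive (fun x => phi x) t) with q. fold p.
    replace (Nat.pred n) with (n - 1)%nat by lia. ring.
  - revert hloc. apply filter_imp. intros s [hs1 _].
    apply (f_equal fst) in hs1. simpl in hs1. lra. }
assert (G2 : Derive (fun s => snd (gamma s)) t = p ^ (n - 1) * S t * q).
{ rewrite (Derive_ext_loc _ (fun s => snd v + phi s ^ (n + k) * f (phi s))).
  - apply is_derive_unique. auto_derive; [easy |].
    change (Derive (fun x => phi x) t) with q.
    change (Derive (fun x => f x) (phi t)) with (Derive f p).
    unfold S, slope_nf. fold p.
    replace (Nat.pred (n + k)) with ((n - 1) + k)%nat by lia.
    replace (p ^ (n + k)) with (p ^ (n - 1) * p ^ (k + 1))
      by (rewrite <- pow_add; f_equal; lia).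
    rewrite pow_add. ring.
  - revert hloc. apply filter_imp. intros s [hs1 _].
    apply (f_equal snd) in hs1. simpl in hs1. lra. }
(* The derivative of the normalizing factor [c] is never computed: its two contributions to [ell]
   cancel because [nu] is orthogonal to [mu]. *)
set (c := fun s => / sqrt (S s ^ 2 + INR n ^ 2)).
assert (ec : ex_derive c t).
{ unfold c. auto_derive. repeat split; try easy; try (simpl in *; lra). }
assert (N1 : Derive (fun s => fst (nu s)) t
             = - (Derive c t * S t + c t * Derive S t)).
{ rewrite (Derive_ext_loc _ (fun s => c s * - S s)).
  - apply is_derive_unique. auto_derive; [easy |].
    change (Derive (fun x => c x) t) with (Derive c t).
    change (Derive (fun x => S x) t) with (Derive S t). ring.
  - revert hloc. apply filter_imp. intros s [_ hs1].
    now rewrite hs1. }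
assert (N2 : Derive (fun s => snd (nu s)) t = Derive c t * (eps * INR n)).
{ rewrite (Derive_ext_loc _ (fun s => c s * (eps * INR n))).
  - apply is_derive_unique. auto_derive; [easy |].
    change (Derive (fun x => c x) t) with (Derive c t). ring.
  - revert hloc. apply filter_imp. intros s [_ hs1].
    now rewrite hs1. }
apply locally_singleton in hloc. destruct hloc as [_ hnu].
unfold beta, ell, mu, J, dot, velocity in hb.
cbn [fst snd] in hb. rewrite G1, G2, N1, N2, hnu in hb.
unfold nu_nf, pscal in hb. cbn [fst snd] in hb.
fold p in hb. change (slope_nf n k f p) with (S t) in hb.
unfold alpha_nf, speed_nf. fold K. change (slope_nf n k f p) with (S t).
rewrite hS in hb. unfold c at 2 in hb.
set (r := sqrt (S t ^ 2 + INR n ^ 2)) in *.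
assert (hr2 : r * r = S t ^ 2 + INR n ^ 2) by (apply sqrt_sqrt; lra).
set (dc := Derive c t) in *. set (x := S t) in *.
replace (p ^ (n - 1)) with (p ^ (n - k) * p ^ (k - 1)) in hb
  by (rewrite <- pow_add; f_equal; lia).
assert (hP : p ^ (k - 1) <> 0) by now apply pow_nonzero.
set (P := p ^ (k - 1)) in *. set (Q := p ^ (n - k)) in *.
set (N := INR n) in *.
(* The relation [beta = alpha ell] with both curvatures evaluated; [eps * eps = 1] turns the squared
   norm in [beta] into [r * r]. *)
assert (hb' : - / r * Q * P * q * (x ^ 2 + N ^ 2)
              = alpha t * (/ r * / r * eps * N * q * P * K)).
{ transitivity (- / r * Q * P * q * (x ^ 2 + eps * eps * N ^ 2));
    [rewrite heps2; ring |].
  etransitivity; [etransitivity; [| exact hb] |]; ring. }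
rewrite <- hr2 in hb'.
apply Rmult_eq_reg_r with (/ r * / r * eps * N * q * P * K).
2: { repeat apply Rmult_integral_contrapositive_currified; try easy;
     try (apply Rinv_neq_0_compat; lra); lra || (destruct heps; lra). }
(* One [eps] comes from [alpha_nf] and one from [ell]; keeping their product visible lets [field]
   treat [eps] as a variable. *)
rewrite <- hb'. transitivity (- (eps * eps) * Q * r * q * P).
- rewrite heps2. field. lra.
- field. repeat split; try easy; lra.
Qed.

Lemma ex_derive_slope_factor (n k : nat) (f : R -> R) (t : R) :
  (forall j : nat, ex_derive_n f j t) -> ex_derive (slope_factor n k f) t.
Proof.
intros h. unfold slope_factor.
assert (e1 : ex_derive f t) by exact (h 1%nat).
assert (e2 : ex_derive (Derive f) t) by exact (h 2%nat).
assert (e3 : ex_derive (Derive (Derive f)) t) by exact (h 3%nat).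
auto_derive. easy.
Qed.

(** At 0 the terms with second and third derivatives of [f] keep a factor [t], so only a multiple of
    [f'(0)] survives. This is where the hypothesis of the case [n = k] enters. *)
Lemma Derive_slope_factor_0 (n k : nat) (f : R -> R) :
  (forall j : nat, ex_derive_n f j 0) -> Derive f 0 = 0 ->
  Derive (slope_factor n k f) 0 = 0.
Proof.
intros h hf. apply is_derive_unique. unfold slope_factor.
assert (e1 : ex_derive f 0) by exact (h 1%nat).
assert (e2 : ex_derive (Derive f) 0) by exact (h 2%nat).
assert (e3 : ex_derive (Derive (Derive f)) 0) by exact (h 3%nat).
auto_derive; [easy |].
change (Derive (fun x => f x) 0) with (Derive f 0).
rewrite hf. ring.
Qed.

Lemma slope_nf_0 (n k : nat) (f : R -> R) :
  (1 <= k)%nat -> slope_nf n k f 0 = 0.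
Proof.
intros hk. unfold slope_nf. rewrite !pow_i by lia. ring.
Qed.

Lemma slope_factor_0 (n k : nat) (f : R -> R) :
  (1 <= k)%nat -> f 0 <> 0 -> slope_factor n k f 0 <> 0.
Proof.
intros hk hf. unfold slope_factor.
assert (0 < INR k) by (apply lt_0_INR; lia).
assert (0 < INR (n + k)) by (apply lt_0_INR; lia).
replace (_ + _ + _) with (INR k * INR (n + k) * f 0) by ring.
repeat apply Rmult_integral_contrapositive_currified; lra.
Qed.

(** The derivative of the speed carries the factor [slope_nf], which vanishes at 0. *)
Lemma is_derive_speed_nf_0 (n k : nat) (f : R -> R) :
  (1 <= n)%nat -> (1 <= k)%nat -> ex_derive f 0 -> ex_derive (Derive f) 0 ->
  is_derive (speed_nf n k f) 0 0.
Proof.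
intros hn hk h1 h2.
assert (0 < INR n) by (apply lt_0_INR; lia).
pose proof (is_derive_slope_nf n k f 0 hk h1 h2) as hs.
assert (es : ex_derive (slope_nf n k f) 0) by (eexists; exact hs).
unfold speed_nf. auto_derive; rewrite slope_nf_0 by assumption.
- repeat split; try easy; try nra.
- ring.
Qed.

(** For [n = k] the power is constant and the speed and the slope factor are both stationary at 0.
    For [k + 2 <= n] the power vanishes to order at least two, whatever the other factors do. *)
Lemma is_derive_alpha_nf_0 (n k : nat) (eps : R) (f : R -> R) :
  (1 <= n)%nat -> (1 <= k)%nat -> f 0 <> 0 ->
  (forall j : nat, ex_derive_n f j 0) ->
  (n = k /\ Derive f 0 = 0) \/ (k + 2 <= n)%nat ->
  is_derive (alpha_nf n k eps f) 0 0.
Proof.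
intros hn hk hf0 hf hcase.
assert (hn0 : 0 < INR n) by (apply lt_0_INR; lia).
pose proof (is_derive_speed_nf_0 n k f hn hk (hf 1%nat) (hf 2%nat)) as hr.
assert (er : ex_derive (speed_nf n k f) 0) by (eexists; exact hr).
pose proof (ex_derive_slope_factor n k f 0 hf) as eK.
pose proof (slope_factor_0 n k f hk hf0) as hK.
unfold alpha_nf. auto_derive.
- repeat split; try easy. apply Rmult_integral_contrapositive_currified; lra.
- change (Derive (fun x => speed_nf n k f x) 0) with (Derive (speed_nf n k f) 0).
  change (Derive (fun x => slope_factor n k f x) 0)
    with (Derive (slope_factor n k f) 0).
  rewrite (is_derive_unique _ _ _ hr).
  destruct hcase as [[<- hd] | hkn].
  + rewrite (Derive_slope_factor_0 n n f hf hd).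
    rewrite Nat.sub_diag. simpl. field. split; [easy | lra].
  + rewrite (pow_i (Nat.pred (n - k))) by lia. rewrite (pow_i (n - k)) by lia.
    field. split; [easy | lra].
Qed.

Lemma ex_derive_alpha_nf_0 (n k : nat) (eps : R) (f : R -> R) :
  (1 <= n)%nat -> (1 <= k)%nat -> f 0 <> 0 ->
  (forall j : nat, ex_derive_n f j 0) -> ex_derive (alpha_nf n k eps f) 0.
Proof.
intros hn hk hf0 hf.
assert (hn0 : 0 < INR n) by (apply lt_0_INR; lia).
pose proof (is_derive_speed_nf_0 n k f hn hk (hf 1%nat) (hf 2%nat)) as hr.
assert (er : ex_derive (speed_nf n k f) 0) by (eexists; exact hr).
pose proof (ex_derive_slope_factor n k f 0 hf) as eK.
pose proof (slope_factor_0 n k f hk hf0) as hK.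
unfold alpha_nf. auto_derive.
repeat split; try easy. apply Rmult_integral_contrapositive_currified; lra.
Qed.

(** * Transfer from the normal form to the curve *)

(** The chain rule applied to [psi (phi t) = t] makes [phi'] nonzero, and the same identity makes
    [phi] injective near [t0]. *)
Lemma diffeo_germ_regular (t0 : R) (phi : R -> R) :
  diffeo_germ t0 phi ->
  locally t0 (fun t => ex_derive phi t /\ Derive phi t <> 0 /\
                       (t <> t0 -> phi t <> 0)).
Proof.
intros [hphi [h0 [psi [hpsi [hpsi0 [hinv _]]]]]].
pose proof (locally_singleton _ _ hphi) as hphi0.
assert (hc : continuous phi t0)
  by exact (ex_derive_continuous phi t0 (hphi0 1%nat)).
assert (hpsi' : locally t0 (fun t => ex_derive psi (phi t))).
{ apply (hc (fun s => ex_derive psi s)). rewrite h0.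
  revert hpsi. unfold smooth_near. apply filter_imp. intros s hs. exact (hs 1%nat). }
(* To be differentiated at each nearby [t], the inverse identity must hold on a neighbourhood of
   that [t]. *)
apply locally_locally in hinv.
unfold smooth_near in hphi.
generalize (filter_and _ _ hphi (filter_and _ _ hpsi' hinv)).
apply filter_imp. intros t [ht1 [ht2 ht3]].
assert (ephi : ex_derive phi t) by exact (ht1 1%nat).
split; [assumption |]. split.
- intros hz.
  pose proof (is_derive_comp psi phi t _ _ (Derive_correct _ _ ht2)
                (Derive_correct _ _ ephi)) as hcomp.
  rewrite hz in hcomp. apply is_derive_unique in hcomp.
  pose proof (eq_trans (eq_sym (Derive_ext_loc _ (fun s => s) t ht3)) hcomp)
    as h01.
  pose proof (eq_trans (eq_sym (Derive_id t)) h01) as h1.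
  change (1 = 0 * Derive psi (phi t)) in h1. lra.
- intros hne hz. apply hne. apply locally_singleton in ht3.
  rewrite <- ht3, hz. assumption.
Qed.

(** At [t0] both [beta] and [ell] may vanish, so [alpha] is not read off there. It agrees with
    [alpha_nf] composed with [phi] at nearby interior points other than [t0]; smoothness carries the
    value and the first derivative over to [t0]. *)
Lemma evolute_function_at_type (a b : R) (gamma nu : R -> plane)
    (alpha : R -> R) (n k : nat) (f : R -> R) (t0 : R) :
  a < b -> evolute_function a b gamma nu alpha ->
  (1 <= k)%nat -> (k <= n)%nat -> of_type_with a b gamma nu n k f t0 ->
  exists eps : R, exists q : R,
    alpha t0 = alpha_nf n k eps f 0 /\
    Derive alpha t0 = q * Derive (alpha_nf n k eps f) 0.
Proof.
intros hab [ha [hb _]] hk hkn [ht0 [hf [hf0 [eps [phi [heps [hphi hloc]]]]]]].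
pose proof (diffeo_germ_regular t0 phi hphi) as hreg.
destruct hphi as [hphi [h0 _]].
pose proof (locally_singleton _ _ hphi) as hphi0.
pose proof (locally_singleton _ _ hf) as hfs.
assert (ephi : ex_derive phi t0) by exact (hphi0 1%nat).
assert (hc : continuous phi t0) by exact (ex_derive_continuous phi t0 ephi).
assert (enf : ex_derive (alpha_nf n k eps f) (phi t0))
  by (rewrite h0; apply ex_derive_alpha_nf_0; (lia || assumption)).
assert (hKnear : locally t0 (fun t => slope_factor n k f (phi t) <> 0)).
{ apply (hc (fun s => slope_factor n k f s <> 0)). rewrite h0.
  pose proof (ex_derive_continuous _ _ (ex_derive_slope_factor n k f 0 hfs))
    as hKc.
  apply (hKc (fun y => y <> 0)).
  apply (open_neq 0). now apply slope_factor_0. }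
assert (hfnear : locally t0 (fun t => forall j, ex_derive_n f j (phi t))).
{ apply (hc (fun s => forall j, ex_derive_n f j s)). now rewrite h0. }
(* The factor [q] is the one given by the chain rule. *)
exists eps, (Derive phi t0).
pose proof (smooth_ex_derive alpha t0 ha) as ea.
assert (ecomp : ex_derive (fun t => alpha_nf n k eps f (phi t)) t0)
  by (apply ex_derive_comp; assumption).
destruct (vanishing_germ_on_interval a b
            (fun t => alpha t - alpha_nf n k eps f (phi t)) t0) as [hv hd];
  try assumption.
- now apply (@ex_derive_minus R_AbsRing R_NormedModule).
- apply locally_locally in hloc.
  generalize (filter_and _ _ hloc
                (filter_and _ _ hreg (filter_and _ _ hKnear hfnear))).
  apply filter_imp. intros t [l1 [[l2 [l3 l4]] [l5 l6]]] ht hne.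
  rewrite (evolute_function_nf a b gamma nu alpha n k eps f phi (gamma t0) t);
    try assumption.
  + ring.
  + now apply l4.
  + exact (l6 1%nat).
  + exact (l6 2%nat).
  (* An interior [t] has a whole neighbourhood inside the interval, where the normal form holds
     unconditionally. *)
  + assert (hin : locally t (fun s => a < s < b))
      by (apply (open_and (fun s => a < s) (fun s => s < b));
          [apply open_gt | apply open_lt | exact ht]).
    generalize (filter_and _ _ l1 hin). apply filter_imp.
    intros s [l hs]. apply l. split; lra.
  + apply hb. split; lra.
- rewrite h0 in hv. split; [lra |].
  rewrite Derive_minus in hd by assumption.
  rewrite (Derive_comp (alpha_nf n k eps f) phi) in hd by assumption.
  rewrite h0 in hd. lra.
Qed.

(** * Rolle's theorem on an arc and across the identified endpoints *)

Lemma rolle_open (alpha : R -> R) (s t : R) :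
  smooth alpha -> s < t -> alpha s = alpha t ->
  exists c, s < c < t /\ Derive alpha c = 0.
Proof.
intros ha hst heq.
destruct (MVT_cor2 alpha (Derive alpha) s t hst) as [c [hc1 hc2]].
{ intros c _. apply is_derive_Reals, Derive_correct. now apply smooth_ex_derive. }
exists c. split; [assumption |].
apply Rmult_eq_reg_r with (t - s); lra.
Qed.

(* Rolle's theorem on the arc from [t] through [a ~ b] to [s]. *)
Lemma rolle_across (a b : R) (alpha : R -> R) (s t : R) :
  smooth alpha -> closes_up a b alpha ->
  a <= s -> s < t < b -> alpha s = alpha t ->
  exists c, (t < c < b \/ a <= c < s) /\ Derive alpha c = 0.
Proof.
intros ha hcl has htb heq.
assert (h0 : alpha a = alpha b) by exact (hcl 0%nat).
assert (h1 : Derive alpha a = Derive alpha b) by exact (hcl 1%nat).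
assert (hcont : continuity (Derive alpha)).
{ intros x. apply continuity_pt_filterlim.
  apply (ex_derive_continuous (Derive alpha)). now apply smooth_ex_derive2. }
assert (hD : forall c, derivable_pt_lim alpha c (Derive alpha c)).
{ intros c. apply is_derive_Reals, Derive_correct. now apply smooth_ex_derive. }
destruct (Req_dec (alpha b) (alpha t)) as [hbt | hbt].
{ destruct (rolle_open alpha t b) as [c [hc hc0]]; try easy.
  exists c. split; [left; lra | assumption]. }
(* If [s] were [a], then [alpha b = alpha a = alpha t], which was excluded just before. *)
assert (has' : a < s).
{ destruct has as [|<-]; [assumption | exfalso; lra]. }
destruct (Req_dec (Derive alpha a) 0) as [hz | hz].
{ exists a. split; [right; lra | assumption]. }
destruct (MVT_cor2 alpha (Derive alpha) t b) as [c1 [hc1 hc1']];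
  [lra | intros; apply hD |].
destruct (MVT_cor2 alpha (Derive alpha) a s) as [c2 [hc2 hc2']];
  [lra | intros; apply hD |].
(* The increments of [alpha] over the two pieces of the arc cancel, so its slopes at [c1] and [c2]
   have opposite signs. One of them is therefore opposed to the common slope at [a] and [b], and the
   intermediate value theorem applies on that side. *)
assert (hsum : Derive alpha c1 * (b - t) = - (Derive alpha c2 * (s - a))) by lra.
destruct (Rle_dec (Derive alpha c1 * Derive alpha b) 0) as [hle | hgt].
- destruct (IVT_cor (Derive alpha) c1 b hcont) as [z [hz1 hz2]]; [lra | easy |].
  (* The slope at [b] equals the nonzero slope at [a]. Keeping [z] off [b] matters because [b] is
     the same point of the circle as [a]. *)
  assert (z <> b) by congruence.
  exists z. split; [left; lra | assumption].
- destruct (IVT_cor (Derive alpha) a c2 hcont) as [z [hz1 hz2]]; [lra | |].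
  + rewrite h1. apply Rmult_le_reg_r with (s - a); [lra |].
    replace (Derive alpha b * Derive alpha c2 * (s - a))
      with (- (Derive alpha c1 * Derive alpha b * (b - t)))
      by (replace (Derive alpha c1 * Derive alpha b * (b - t))
            with (Derive alpha b * (Derive alpha c1 * (b - t))) by ring;
          rewrite hsum; ring).
    nra.
  + exists z. split; [right; lra | assumption].
Qed.

(** * Ordering finite sets of points *)

(** Insertion sort; the absence of duplicates makes the order strict. *)
Lemma sorted_of_NoDup (l : list R) :
  NoDup l -> exists l', StronglySorted Rlt l' /\ length l' = length l /\
    forall t, In t l' <-> In t l.
Proof.
induction 1 as [| x l hx _ [l' [hs [hlen hin]]]].
{ exists nil. repeat split; auto. constructor. }
assert (hx' : ~ In x l') by now rewrite hin.
assert (hins : exists l'', StronglySorted Rlt l'' /\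
                 length l'' = S (length l') /\
                 forall t, In t l'' <-> t = x \/ In t l').
{ clear - hs hx'. induction hs as [| y l' hs IH hy].
  { exists (x :: nil). split; [repeat constructor |].
    split; [reflexivity | simpl; intuition auto]. }
  destruct (Rtotal_order x y) as [h | [h | h]].
  - exists (x :: y :: l'). repeat split; try (simpl; intuition auto; fail).
    constructor; [now constructor |]. constructor; [assumption |].
    revert hy. apply Forall_impl. intros; lra.
  - subst. simpl in hx'. tauto.
  - destruct IH as [l'' [h1 [h2 h3]]]; [simpl in hx'; tauto |].
    exists (y :: l''). repeat split.
    + constructor; [assumption |]. rewrite Forall_forall in *.
      intros t ht. apply h3 in ht. destruct ht as [-> |]; auto.
    + simpl. now rewrite h2.
    + simpl. rewrite h3. tauto.
    + simpl. rewrite h3. tauto. }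
destruct hins as [l'' [h1 [h2 h3]]].
exists l''. repeat split; [assumption | simpl; lia | |];
  simpl; rewrite h3, hin; intuition auto.
Qed.

Lemma at_least_sorted (N : nat) (P : R -> Prop) :
  at_least N P ->
  exists l, StronglySorted Rlt l /\ length l = N /\ List.Forall P l.
Proof.
intros [l [hnd [hlen hP]]].
destruct (sorted_of_NoDup l hnd) as [l' [h1 [h2 h3]]].
exists l'. repeat split; [assumption | lia |].
rewrite Forall_forall. intros t ht. now apply hP, h3.
Qed.

Lemma at_least_4_intro (P : R -> Prop) (x y z w : R) :
  P x -> P y -> P z -> P w -> x <> y -> x <> z -> x <> w -> y <> z -> y <> w ->
  z <> w -> at_least 4 P.
Proof.
intros. exists (x :: y :: z :: w :: nil). repeat split.
- repeat constructor; simpl; intuition auto.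
- simpl. intuition (subst; assumption).
Qed.

(* In the last two cases the curve is closed, so a and b are the same point
   and points are counted on t < b. On an arc these cases fail: Rolle's theorem
   yields only three vertices, and three can occur. *)
Theorem proposition3p8 (a b : R) (hab : a < b) (gamma nu : R -> plane)
  (alpha : R -> R) (hL : legendre_curve a b gamma nu)
  (halpha : evolute_function a b gamma nu alpha)
  (n k : nat) (hn : (1 <= n)%nat) (hk : (1 <= k)%nat) :
  (n = k ->
    at_least 4 (fun t => exists f : R -> R,
      of_type_with a b gamma nu n k f t /\ Derive f 0 = 0) ->
    at_least 4 (vertex a b gamma nu)) /\
  (n = (k + 1)%nat ->
    closes_up a b alpha ->
    at_least 4 (fun t => t < b /\ of_type a b gamma nu n k t) ->
    at_least 4 (fun t => t < b /\ vertex a b gamma nu t)) /\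
  ((k + 2 <= n)%nat ->
    closes_up a b alpha ->
    at_least 2 (fun t => t < b /\ of_type a b gamma nu n k t) ->
    at_least 4 (fun t => t < b /\ vertex a b gamma nu t)).
Proof.
assert (hv : forall t, in_interval a b t -> Derive alpha t = 0 ->
               vertex a b gamma nu t)
  by (intros t; now apply vertex_of_critical).
assert (hsm : smooth alpha) by apply halpha.
(* For [k < n] the positive power of the parameter in [alpha_nf] vanishes at 0. *)
assert (hz : (k < n)%nat -> forall t, of_type a b gamma nu n k t -> alpha t = 0).
{ intros hkn t [f hf].
  destruct (evolute_function_at_type a b gamma nu alpha n k f t)
    as [eps [q [h _]]]; try easy; [lia |].
  rewrite h. unfold alpha_nf. rewrite pow_i by lia. unfold Rdiv. ring. }
assert (hd : forall t f, of_type_with a b gamma nu n k f t ->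
          (n = k /\ Derive f 0 = 0) \/ (k + 2 <= n)%nat -> Derive alpha t = 0).
{ intros t f hf hcase.
  destruct (evolute_function_at_type a b gamma nu alpha n k f t)
    as [eps [q [_ h]]]; try easy; [lia |].
  destruct hf as [_ [hf [hf0 _]]].
  rewrite h, (is_derive_unique _ 0 0); [ring |].
  apply is_derive_alpha_nf_0; try easy. exact (locally_singleton _ _ hf). }
split; [| split].
- intros hnk [l [hnd [hlen hl]]].
  (* For [n = k] the four given points are themselves the vertices. *)
  exists l. repeat split; try easy;
    destruct (hl t H) as [f [hf hf']]; try apply hf.
  apply hv; [apply hf |]. apply (hd t f); tauto.
- intros hnk hcl h4.
  destruct (at_least_sorted _ _ h4) as [l [hs [hlen hP]]].
  destruct l as [|x [|y [|z [|w [|]]]]]; try discriminate.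
  rewrite Forall_forall in hP.
  destruct (hP x) as [_ hx]; [simpl; tauto |].
  destruct (hP y) as [_ hy]; [simpl; tauto |].
  destruct (hP z) as [_ hz']; [simpl; tauto |].
  destruct (hP w) as [hwb hw]; [simpl; tauto |].
  assert (hax : a <= x) by (destruct hx as [f [hx _]]; apply hx).
  apply hz in hx, hy, hz', hw; try lia.
  assert (hord : x < y < z /\ z < w).
  { repeat match goal with
      | H : StronglySorted _ (_ :: _) |- _ => inversion_clear H
      | H : List.Forall _ (_ :: _) |- _ => inversion_clear H
      end. lra. }
  (* The four zeros of [alpha] cut the circle into four arcs: three lie inside the interval, and the
     last runs from [w] through the endpoints to [x]. Each arc contributes one vertex. *)
  destruct (rolle_open alpha x y) as [c1 [h1 d1]]; [easy | lra | lra |].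
  destruct (rolle_open alpha y z) as [c2 [h2 d2]]; [easy | lra | lra |].
  destruct (rolle_open alpha z w) as [c3 [h3 d3]]; [easy | lra | lra |].
  destruct (rolle_across a b alpha x w) as [c4 [h5 d4]]; try easy; try lra.
  apply (at_least_4_intro _ c1 c2 c3 c4); try lra;
    (split; [lra | apply hv; [split; lra | assumption]]).
- intros hnk hcl h2.
  destruct (at_least_sorted _ _ h2) as [l [hs [hlen hP]]].
  destruct l as [|x [|y [|]]]; try discriminate.
  rewrite Forall_forall in hP.
  destruct (hP x) as [_ hx]; [simpl; tauto |].
  destruct (hP y) as [hyb hy]; [simpl; tauto |].
  assert (hax : a <= x) by (destruct hx as [f [hx _]]; apply hx).
  assert (dx : Derive alpha x = 0)
    by (destruct hx as [f hx]; apply (hd x f); tauto).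
  assert (dy : Derive alpha y = 0)
    by (destruct hy as [f hy]; apply (hd y f); tauto).
  apply hz in hx, hy; try lia.
  assert (hord : x < y).
  { inversion_clear hs. match goal with H : List.Forall _ _ |- _ => now inversion H end. }
  (* Here [x] and [y] are already vertices; as zeros of [alpha] they also bound two arcs of the
     circle, each with a further vertex. *)
  destruct (rolle_open alpha x y) as [c1 [h1 d1]]; [easy | lra | lra |].
  destruct (rolle_across a b alpha x y) as [c2 [h3 d2]]; try easy; try lra.
  apply (at_least_4_intro _ x c1 y c2); try lra;
    (split; [lra | apply hv; [split; lra | assumption]]).
Qed.
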